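(* There is a $\frac{2e-2}{13e-9}$-approximation algorithm for the problem of maximizing a smooth submodular function $F\colon[0,1]^X\to\mathbb{R}_+$ over a solvable packing polytope $P\subseteq[0,1]^X$; that is, the algorithm outputs a point $y\in P$ with $F(y)\ge \frac{2e-2}{13e-9}\max_{x\in P}F(x)$.
   Context: A packing polytope is a polytope $P\subseteq[0,1]^X$ that is down-monotone: if $x\preceq y$ coordinatewise and $y\in P$ then $x\in P$. $P$ is solvable if linear functions can be maximized over $P$ in polynomial time. A smooth submodular function is a twice differentiable function $F$ on $[0,1]^X$ with $\frac{\partial^2F}{\partial y_i\partial y_j}\le 0$ for all $i,j$; it is not assumed monotone. (The multilinear extension $F(x)=\sum_{S\subseteq X}f(S)\prod_{i\in S}x_i\prod_{i\notin S}(1-x_i)$ of a non-negative submodular set function $f$ is an example.) *)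

(* Defs.v *)
(* MathComp / MathComp-Analysis *)
From HB Require Import structures.
From mathcomp Require Import all_boot all_order all_algebra.
From mathcomp Require Import all_classical all_reals all_analysis.
Set Implicit Arguments.
Unset Strict Implicit.
Unset Printing Implicit Defensive.
Import Order.TTheory GRing.Theory Num.Theory.
Import numFieldNormedType.Exports.
Local Open Scope classical_set_scope.
Local Open Scope ring_scope.

(* The ground set X is {0, ..., n-1}; points of R^X are row vectors. *)

Definition cube (R : realType) (n : nat) : set 'rV[R]_n :=
  [set x | forall i, 0 <= x 0 i <= 1].

Definition polyhedron (R : realType) (n : nat) (P : set 'rV[R]_n) : Prop :=
  exists (m : nat) (A : 'M[R]_(m, n)) (b : 'cV[R]_m),
    P = [set x | forall k, (A *m x^T) k 0 <= b k 0].

Definition down_monotone (R : realType) (n : nat) (P : set 'rV[R]_n) : Prop :=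
  forall x y : 'rV[R]_n, cube x -> (forall i, x 0 i <= y 0 i) -> P y -> P x.

(* A polyhedron inside the cube is bounded, hence a polytope.  Nonemptiness
   is what makes max_{x in P} F(x) meaningful. *)
Definition packing_polytope (R : realType) (n : nat) (P : set 'rV[R]_n) : Prop :=
  [/\ polyhedron P, P !=set0, P `<=` @cube R n & down_monotone P].

Definition linear_maximizer (R : realType) (n : nat) (P : set 'rV[R]_n)
    (lin : 'rV[R]_n -> 'rV[R]_n) : Prop :=
  forall c, P (lin c) /\
    forall x, P x -> \sum_i c 0 i * x 0 i <= \sum_i c 0 i * lin c 0 i.

(* Differentiability at x relative to A, with gradient g.  The library's
   'd F x looks at a full neighbourhood of x and so would constrain a function
   on the closed cube outside its domain.  Relative to the cube the gradient
   is unique, also at boundary points. *)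
Definition has_gradient_within (R : realType) (n : nat) (A : set 'rV[R]_n)
    (F : 'rV[R]_n -> R) (x g : 'rV[R]_n) : Prop :=
  forall eps : R, 0 < eps -> \forall y \near within A (nbhs x),
    `|F y - F x - \sum_i g 0 i * (y 0 i - x 0 i)| <= eps * `|y - x|.

(* Values of F outside the cube are irrelevant. *)
Definition smooth_submodular (R : realType) (n : nat) (F : 'rV[R]_n -> R) : Prop :=
  exists (dF : 'rV[R]_n -> 'rV[R]_n) (d2F : 'rV[R]_n -> 'M[R]_n),
    forall x, cube x ->
      [/\ has_gradient_within (@cube R n) F x (dF x),
          forall i, has_gradient_within (@cube R n) (fun y => dF y 0 i) x
                      (row i (d2F x))
        & forall i j, d2F x i j <= 0].

Definition approx_maximizer (R : realType) (n : nat) (alpha : R)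
    (F : 'rV[R]_n -> R) (P : set 'rV[R]_n) (y : 'rV[R]_n) : Prop :=
  P y /\ forall x, P x -> alpha * F x <= F y.

(* Algorithms are programs for a real RAM: exact real arithmetic and comparison
   at unit cost, natural-number registers for counting and indexing, and two
   oracles, one for the value of F and one maximizing linear functions over P.
   There are no real constants other than 0 and 1, no conversion between reals
   and naturals, and no multiplication of naturals (which at unit cost would
   allow repeated squaring of indices). *)

Inductive nexpr : Set :=
| NReg of nat
| NConst of nat
| NAdd of nexpr & nexpr.

(* RGet a e is the entry at index e of array a. *)
Inductive rexpr : Set :=
| RReg of nat
| RGet of nat & nexpr
| RZero
| ROne
| RAdd of rexpr & rexpr
| RSub of rexpr & rexpr
| RMul of rexpr & rexpr
| RDiv of rexpr & rexpr.

Inductive bexpr : Set :=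
| BNLt of nexpr & nexpr
| BRLt of rexpr & rexpr
| BNot of bexpr.

Inductive cmd : Set :=
| Skip
| NSet of nat & nexpr
| RSet of nat & rexpr
| ASet of nat & nexpr & rexpr
| QValue of nat & nat  (* QValue r a : real register r := F (array a) *)
| QLin of nat & nat    (* QLin a b : array a := maximizer of <array b, .> on P *)
| Seq of cmd & cmd
| If of bexpr & cmd & cmd
| While of bexpr & cmd.

Record state (R : realType) : Type := State {
  nregs : nat -> nat;
  rregs : nat -> R;
  arrays : nat -> nat -> R }.

Definition upd (T : Type) (f : nat -> T) (k : nat) (v : T) : nat -> T :=
  fun j => if j == k then v else f j.

Fixpoint neval (R : realType) (s : state R) (e : nexpr) : nat :=
  match e with
  | NReg k => nregs s k
  | NConst k => k
  | NAdd e1 e2 => (neval s e1 + neval s e2)%N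
  end.

Fixpoint reval (R : realType) (s : state R) (e : rexpr) : R :=
  match e with
  | RReg k => rregs s k
  | RGet a i => arrays s a (neval s i)
  | RZero => 0
  | ROne => 1
  | RAdd e1 e2 => reval s e1 + reval s e2
  | RSub e1 e2 => reval s e1 - reval s e2
  | RMul e1 e2 => reval s e1 * reval s e2
  | RDiv e1 e2 => reval s e1 / reval s e2
  end.

Fixpoint beval (R : realType) (s : state R) (b : bexpr) : bool :=
  match b with
  | BNLt e1 e2 => (neval s e1 < neval s e2)%N
  | BRLt e1 e2 => reval s e1 < reval s e2
  | BNot b1 => ~~ beval s b1
  end.

Definition set_nreg (R : realType) (s : state R) (k v : nat) : state R :=
  State (upd (nregs s) k v) (rregs s) (arrays s).

Definition set_rreg (R : realType) (s : state R) (k : nat) (v : R) : state R :=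
  State (nregs s) (upd (rregs s) k v) (arrays s).

Definition set_array (R : realType) (s : state R) (a : nat) (v : nat -> R) :
    state R :=
  State (nregs s) (rregs s) (upd (arrays s) a v).

Definition vec_of_array (R : realType) (n : nat) (a : nat -> R) : 'rV[R]_n :=
  \row_(i < n) a i.

Definition array_of_vec (R : realType) (n : nat) (x : 'rV[R]_n) : nat -> R :=
  fun k => if insub k is Some i then x 0 i else 0.

(* exec F lin c s s' t: from state s, program c halts in state s' after t steps.
   Every assignment and every test costs one step (expressions in a fixed
   program have fixed size), and an oracle call costs n + 1 steps. *)
Inductive exec (R : realType) (n : nat) (F : 'rV[R]_n -> R)
    (lin : 'rV[R]_n -> 'rV[R]_n) : cmd -> state R -> state R -> nat -> Prop :=
| ExecSkip s : exec F lin Skip s s 1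
| ExecNSet s k e : exec F lin (NSet k e) s (set_nreg s k (neval s e)) 1
| ExecRSet s k e : exec F lin (RSet k e) s (set_rreg s k (reval s e)) 1
| ExecASet s a i e : exec F lin (ASet a i e) s
    (set_array s a (upd (arrays s a) (neval s i) (reval s e))) 1
| ExecQValue s k a : exec F lin (QValue k a) s
    (set_rreg s k (F (vec_of_array n (arrays s a)))) n.+1
| ExecQLin s a b : exec F lin (QLin a b) s
    (set_array s a (array_of_vec (lin (vec_of_array n (arrays s b))))) n.+1
| ExecSeq c1 c2 s s1 s2 t1 t2 : exec F lin c1 s s1 t1 ->
    exec F lin c2 s1 s2 t2 -> exec F lin (Seq c1 c2) s s2 (t1 + t2)%N
| ExecIf b c1 c2 s s1 t1 :
    exec F lin (if beval s b then c1 else c2) s s1 t1 ->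
    exec F lin (If b c1 c2) s s1 t1.+1
| ExecWhileEnd b c s : ~~ beval s b -> exec F lin (While b c) s s 1
| ExecWhileStep b c s s1 s2 t1 t2 : beval s b -> exec F lin c s s1 t1 ->
    exec F lin (While b c) s1 s2 t2 ->
    exec F lin (While b c) s s2 (t1 + t2).+1.

(* The input n is in natural register 0, the output vector in array 0. *)
Definition init_state (R : realType) (n : nat) : state R :=
  State (upd (fun=> 0%N) 0 n) (fun=> 0) (fun _ _ => 0).

Definition output (R : realType) (n : nat) (s : state R) : 'rV[R]_n :=
  vec_of_array n (arrays s 0).

(* Main.v *)
(* The ratio (2e-2)/(13e-9) is below 2/13, and a continuous greedy algorithm with
   constant step size eps, run for total time 1/2, achieves 2/13.  Only values
   of F are available and no bound on its derivatives is known, so the partial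
   derivatives are replaced by difference quotients g_i of width h u_i, where
   u_i is the maximum of x_i over P.  Two facts replace smoothness bounds.
   - Submodularity makes each g_i antitone, and the gain of a step x -> y is at
     least eps <v, g(y)>, so the discretization error eps <v, g(x) - g(y)> is
     dominated by the decrease of sum_i u_i g_i; it telescopes, and in total
     costs at most (eps/h) n times the optimum.
   - A point o of P can be moved, losing a small fraction of F(o), to a point z of
     P with z_i >= 2 h u_i; for x with entries at most 1/2 the vector
     d = z (1 - x) then satisfies d_i >= h u_i, so that
     F(x + d) - F(x) <= <d, g(x)>, while F(x + d) >= F(z)/2.
   With A close to F(o)/2 this gives F(y) - F(x) >= eps (A - F(x)) up to the
   telescoping error, hence a final value close to A/3 = F(o)/6. *)
Require Import Defs.
From mathcomp Require Import all_boot all_order all_algebra.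
From mathcomp Require Import all_classical all_reals all_analysis.
From mathcomp Require Import ring lra zify.
Set Implicit Arguments.
Unset Strict Implicit.
Unset Printing Implicit Defensive.
Import Order.TTheory GRing.Theory Num.Theory.
Import numFieldNormedType.Exports.
Local Open Scope classical_set_scope.
Local Open Scope ring_scope.

(** * One-variable comparison *)

Section UnitInterval.
Variable R : realType.
Implicit Types (f g df dg : R -> R) (t c : R).

(** Differentiability relative to [[0,1]], one-sided at the endpoints, so that curves ending on the
    boundary of the cube are covered. *)
Definition derivative01 f df := forall t, 0 <= t <= 1 -> forall eps, 0 < eps ->
  \forall s \near nbhs t, 0 <= s <= 1 ->
    `|f s - f t - df t * (s - t)| <= eps * `|s - t|.

Lemma derivative01D f df g dg : derivative01 f df -> derivative01 g dg ->
  derivative01 (fun t => f t + g t) (fun t => df t + dg t).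
Proof.
move=> Df Dg t t01 eps eps0.
have eps2 : 0 < eps / 2 by rewrite divr_gt0.
near=> s => s01.
have -> : f s + g s - (f t + g t) - (df t + dg t) * (s - t) =
  (f s - f t - df t * (s - t)) + (g s - g t - dg t * (s - t)) by ring.
rewrite (le_trans (ler_normD _ _))// [leRHS](_ : _ =
  eps / 2 * `|s - t| + eps / 2 * `|s - t|); last by field.
apply: lerD; move: s01.
  by near: s; exact: Df.
by near: s; exact: Dg.
Unshelve. all: by end_near. Qed.

Lemma derivative01Z c f df : derivative01 f df ->
  derivative01 (fun t => c * f t) (fun t => c * df t).
Proof.
move=> Df t t01 eps eps0.
have c0 : 0 < `|c| + 1 by rewrite ltr_wpDl.
have epsc : 0 < eps / (`|c| + 1) by rewrite divr_gt0.
near=> s => s01.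
have -> : c * f s - c * f t - c * df t * (s - t) =
  c * (f s - f t - df t * (s - t)) by ring.
rewrite normrM; apply: (@le_trans _ _ ((`|c| + 1) * (eps / (`|c| + 1) * `|s - t|))).
  apply: ler_pM => //; first by rewrite lerDl.
  by move: s01; near: s; exact: Df.
by rewrite mulrA mulrCA divff ?mulr1// gt_eqF.
Unshelve. all: by end_near. Qed.

Lemma derivative01_sum (I : Type) (r : seq I) (f df : I -> R -> R) :
  (forall i, derivative01 (f i) (df i)) ->
  derivative01 (fun t => \sum_(i <- r) f i t) (fun t => \sum_(i <- r) df i t).
Proof.
move=> Df; elim: r => [|i r IH].
  move=> t t01 eps eps0; near=> s => _.
  by rewrite !big_nil mul0r !subr0 normr0 mulr_ge0// ltW.
have -> : (fun t => \sum_(j <- i :: r) f j t) =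
    (fun t => f i t + \sum_(j <- r) f j t) by apply: funext => t; rewrite big_cons.
have -> : (fun t => \sum_(j <- i :: r) df j t) =
    (fun t => df i t + \sum_(j <- r) df j t) by apply: funext => t; rewrite big_cons.
exact: derivative01D.
Unshelve. all: by end_near. Qed.

Lemma derivative01_continuous f df : derivative01 f df ->
  {within `[0, 1], continuous f}.
Proof.
move=> Df; apply/subspace_continuousP => t; rewrite /= in_itv/= => t01.
apply/cvgrPdist_le => eps eps0; rewrite near_withinE.
have d0 : 0 < 1 + `|df t| by rewrite ltr_pwDl.
have e0 : 0 < eps / (1 + `|df t|) by rewrite divr_gt0.
near=> s; rewrite /= in_itv/= => s01.
have : `|t - s| <= eps / (1 + `|df t|).
  near: s; apply: (@cvgr_dist_le _ _ _ (nbhs t) _ id t) => //.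
have : `|f s - f t - df t * (s - t)| <= 1 * `|s - t|.
  by move: s01; near: s; exact: Df.
rewrite mul1r => H1; rewrite ler_pdivlMr// => H2.
have : `|f s - f t| <= `|s - t| * (1 + `|df t|).
  have -> : f s - f t = (f s - f t - df t * (s - t)) + df t * (s - t) by ring.
  apply: (le_trans (ler_normD _ _)); rewrite [leRHS]mulrDr mulr1.
  by apply: lerD; rewrite // normrM mulrC.
by move=> H3; rewrite distrC (le_trans H3)// distrC.
Unshelve. all: by end_near. Qed.

Lemma derivative01_derivable f df t : derivative01 f df -> 0 < t < 1 ->
  is_derive t 1 f (df t).
Proof.
move=> Df /andP[t0 t1].
suff H : (fun h => h^-1 *: ((f \o shift t) (h *: 1) - f t)) @ 0^' --> df t.
  by apply: DeriveDef; [apply/cvg_ex; exists (df t)|exact: cvg_lim].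
apply/cvgrPdist_le => eps eps0.
have : \forall s \near t, `|f s - f t - df t * (s - t)| <= eps * `|s - t|.
  near=> s.
  have : 0 <= s <= 1.
    apply/andP; split; apply: ltW; near: s; [exact: lt_nbhsr|exact: lt_nbhsl].
  by near: s; apply: Df => //; rewrite !ltW.
rewrite (near_shift 0 t)/= subr0 => {}H.
near=> h; rewrite /shift/=.
have h0 : h != 0 by near: h; exact: nbhs_dnbhs_neq.
have : `|f (h + t) - f t - df t * (h + t - t)| <= eps * `|h + t - t|.
  by near: h; apply: nbhs_dnbhs.
rewrite addrK => Hh.
rewrite -(ler_pM2r (_ : 0 < `|h|)) ?normr_gt0// -normrM; apply: le_trans Hh.
rewrite -normrN /GRing.scale/= mulr1 le_eqVlt; apply/orP; left; apply/eqP.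
by congr `|_|; field.
Unshelve. all: by end_near. Qed.

(** The mean value theorem asks for derivatives only inside the interval and for continuity up to
    its ends. Antitonicity of the gradient, concavity and both coordinate comparisons below apply
    this to a suitable combination of curves. *)
Lemma derivative01_le0 f df : derivative01 f df ->
  (forall t, 0 <= t <= 1 -> df t <= 0) -> f 1 <= f 0.
Proof.
move=> Df df0.
have D t : t \in `]0, 1[ -> is_derive t 1 f (df t).
  by rewrite in_itv/= => t01; exact: derivative01_derivable.
apply: (@ler0_derive1_nincr _ f 0 1) => //.
- by move=> t /D.
- move=> t t01; rewrite derive1E; have -> := @derive_val _ _ _ _ _ _ _ (D _ t01).
  by apply: df0; move: t01; rewrite in_itv/= => /andP[/ltW-> /ltW->].
- exact: derivative01_continuous Df.
Qed.

End UnitInterval.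

(** * Functions with antitone gradient on the cube *)

Section DRSubmodular.
Variables (R : realType) (n : nat).
Implicit Types (x y a b w : 'rV[R]_n) (t : R).

Definition lev x y := forall i, x 0 i <= y 0 i.

Lemma cube_segment a w t : cube a -> cube (a + w) -> 0 <= t <= 1 ->
  cube (a + t *: w).
Proof.
move=> ca caw /andP[t0 t1] i; move: (ca i) (caw i); rewrite !mxE => H1 H2.
nra.
Qed.

Lemma curve_derivative (G : 'rV[R]_n -> R) (dG : 'rV[R]_n -> 'rV[R]_n) a w :
  (forall x, cube x -> has_gradient_within (@cube R n) G x (dG x)) ->
  cube a -> cube (a + w) ->
  derivative01 (fun t => G (a + t *: w))
    (fun t => \sum_j dG (a + t *: w) 0 j * w 0 j).
Proof.
move=> DG ca caw t t01 eps eps0.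
have w0 : 0 < `|w| + 1 by rewrite ltr_wpDl.
have e0 : 0 < eps / (`|w| + 1) by rewrite divr_gt0.
have := DG _ (cube_segment ca caw t01) _ e0.
rewrite near_withinE => H.
have C : (fun s => a + s *: w) @ t --> a + t *: w.
  by apply: cvgD; [exact: cvg_cst|apply: cvgZr_tmp; exact: cvg_id].
near=> s => s01.
have : cube (a + s *: w) -> `|G (a + s *: w) - G (a + t *: w) -
    \sum_i dG (a + t *: w) 0 i * ((a + s *: w) 0 i - (a + t *: w) 0 i)| <=
    eps / (`|w| + 1) * `|a + s *: w - (a + t *: w)|.
  by near: s; exact: (C _ H).
move=> /(_ (cube_segment ca caw s01)).
have -> : a + s *: w - (a + t *: w) = (s - t) *: w.
  by rewrite opprD addrACA subrr add0r scalerBl.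
have -> : \sum_i dG (a + t *: w) 0 i * ((a + s *: w) 0 i - (a + t *: w) 0 i) =
    (\sum_j dG (a + t *: w) 0 j * w 0 j) * (s - t).
  by rewrite mulr_suml; apply: eq_bigr => i _; rewrite !mxE; ring.
move=> /le_trans; apply; rewrite normrZ mulrAC ler_pdivrMr// -mulrA.
by rewrite ler_pM2l// ler_wpM2l// lerDl.
Unshelve. all: by end_near. Qed.

(** The first-order (diminishing-returns) form of submodularity, on which the later estimates
    rest. *)
Definition dr_gradient (F : 'rV[R]_n -> R) (dF : 'rV[R]_n -> 'rV[R]_n) :=
  (forall x, cube x -> has_gradient_within (@cube R n) F x (dF x)) /\
  (forall x y, cube x -> cube y -> lev x y -> lev (dF y) (dF x)).

(** Along the segment from [x] to [y] a partial derivative changes at the rate of a row of [d2F]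
    paired with the nonnegative vector [y - x], which is at most 0. *)
Lemma smooth_submodular_dr F : smooth_submodular F ->
  exists dF, dr_gradient F dF.
Proof.
move=> [dF [d2F H]]; exists dF; split=> [x /H[]//|x y cx cy xy i].
have cxy : cube (x + (y - x)) by rewrite addrCA subrr addr0.
have D := curve_derivative
  (G := fun y => dF y 0 i) (dG := fun z => row i (d2F z))
  (fun z (cz : cube z) => let: And3 _ h _ := H z cz in h i) cx cxy.
have /= := derivative01_le0 D.
rewrite scale1r scale0r addr0 addrCA subrr addr0; apply.
move=> t t01; apply: sumr_le0 => j _.
have [_ _ /(_ i j) d2] := H _ (cube_segment cx cxy t01).
by rewrite mxE mulr_le0_ge0// !mxE subr_ge0.
Qed.

Variables (F : 'rV[R]_n -> R) (dF : 'rV[R]_n -> 'rV[R]_n).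
Hypothesis FdF : dr_gradient F dF.

Let Fcurve a w := @curve_derivative F dF a w (proj1 FdF).

(** Compare [s * F] along [a + t (b - a)] with [F] along [a + t s (b - a)]: the second curve stays
    below the first in the cube, so its gradient is larger while both have direction [s (b - a)]. *)
Lemma dr_concave a b s : cube a -> cube b -> lev a b -> 0 <= s <= 1 ->
  (1 - s) * F a + s * F b <= F (a + s *: (b - a)).
Proof.
move=> ca cb ab s01.
have cab : cube (a + (b - a)) by rewrite addrCA subrr addr0.
have cs := cube_segment ca cab s01.
have /= := derivative01_le0 (derivative01D (derivative01Z s (Fcurve ca cab))
  (derivative01Z (-1) (Fcurve ca cs))).
rewrite !scale1r !scale0r !addr0 (addrCA a b) subrr addr0 => H.
suff: s * F b + -1 * F (a + s *: (b - a)) <= s * F a + -1 * F a by lra.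
apply: H => t t01.
rewrite mulN1r mulr_sumr -sumrB; apply: sumr_le0 => j _; rewrite !mxE.
case/andP: (s01) (t01) => s0 s1 /andP[t0 t1].
have -> : s * (dF (a + t *: (b - a)) 0 j * (b 0 j - a 0 j)) -
    dF (a + t *: (s *: (b - a))) 0 j * (s * (b 0 j - a 0 j)) =
    s * (b 0 j - a 0 j) *
    (dF (a + t *: (b - a)) 0 j - dF (a + t *: (s *: (b - a))) 0 j) by ring.
rewrite mulr_ge0_le0 ?mulr_ge0 ?subr_ge0 ?subr_le0//.
apply: (proj2 FdF); [exact: cube_segment|exact: cube_segment|] => i.
rewrite !mxE lerD2l ler_wpM2l// ler_piMl// subr_ge0//.
Qed.

Section CoordinateCurves.
Variables (x y w : 'rV[R]_n) (h k : 'I_n -> R).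
Hypotheses (cx : cube x) (cxw : cube (x + w)) (cy : cube y).
Hypothesis cyh : forall i, cube (y + h i *: delta_mx 0 i).
Hypothesis khw : forall i, k i * h i = w 0 i.
Hypothesis w0 : forall i, 0 <= w 0 i.

(** Since [k i * h i = w 0 i], both sides integrate partial derivatives with the same weights [w]:
    on the left along [x + t w], on the right each along its own coordinate bump from [y]. The order
    of the curves orders the integrands term by term. *)
Lemma dr_coordinate_ub :
  (forall i t, 0 <= t <= 1 -> lev (y + t *: (h i *: delta_mx 0 i)) (x + t *: w)) ->
  F (x + w) - F x <= \sum_i k i * (F (y + h i *: delta_mx 0 i) - F y).
Proof.
move=> yx.
have /= := derivative01_le0 (derivative01D (Fcurve cx cxw)
  (derivative01Z (-1) (derivative01_sum (index_enum 'I_n)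
    (fun i => derivative01Z (k i) (Fcurve cy (cyh i)))))).
rewrite !scale1r !scale0r !addr0 => H.
under eq_bigr do rewrite mulrBr.
rewrite sumrB.
suff: F (x + w) + -1 * (\sum_i k i * F (y + h i *: delta_mx 0 i)) <=
  F x + -1 * (\sum_i k i * F y) by lra.
have E0 : \sum_i k i * F (y + 0 *: (h i *: delta_mx 0 i)) = \sum_i k i * F y.
  by apply: eq_bigr => i _; rewrite scale0r addr0.
have E1 : \sum_i k i * F (y + 1 *: (h i *: delta_mx 0 i)) =
    \sum_i k i * F (y + h i *: delta_mx 0 i).
  by apply: eq_bigr => i _; rewrite scale1r.
rewrite -E0 -E1; apply: H => t t01; rewrite mulN1r -sumrB; apply: sumr_le0 => i _.
rewrite (bigD1 i)//= big1 => [|j ji]; last by rewrite !mxE (negPf ji) andbF !mulr0.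
rewrite !mxE !eqxx addr0 /= mulr1 mulrCA khw -mulrBl mulr_le0_ge0// subr_le0.
apply: (proj2 FdF); [exact: cube_segment|exact: cube_segment|exact: yx].
Qed.

Lemma dr_coordinate_lb :
  (forall i t, 0 <= t <= 1 -> lev (x + t *: w) (y + t *: (h i *: delta_mx 0 i))) ->
  \sum_i k i * (F (y + h i *: delta_mx 0 i) - F y) <= F (x + w) - F x.
Proof.
move=> xy.
have /= := derivative01_le0 (derivative01D (derivative01Z (-1) (Fcurve cx cxw))
  ((derivative01_sum (index_enum 'I_n)
    (fun i => derivative01Z (k i) (Fcurve cy (cyh i)))))).
rewrite !scale1r !scale0r !addr0 => H.
under eq_bigr do rewrite mulrBr.
rewrite sumrB.
suff: -1 * F (x + w) + (\sum_i k i * F (y + h i *: delta_mx 0 i)) <=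
  -1 * F x + (\sum_i k i * F y) by lra.
have E0 : \sum_i k i * F (y + 0 *: (h i *: delta_mx 0 i)) = \sum_i k i * F y.
  by apply: eq_bigr => i _; rewrite scale0r addr0.
have E1 : \sum_i k i * F (y + 1 *: (h i *: delta_mx 0 i)) =
    \sum_i k i * F (y + h i *: delta_mx 0 i).
  by apply: eq_bigr => i _; rewrite scale1r.
rewrite -E0 -E1; apply: H => t t01; rewrite mulN1r addrC -sumrB; apply: sumr_le0 => i _.
rewrite (bigD1 i)//= big1 => [|j ji]; last by rewrite !mxE (negPf ji) andbF !mulr0.
rewrite !mxE !eqxx addr0 /= mulr1 mulrCA khw -mulrBl mulr_le0_ge0// subr_le0.
apply: (proj2 FdF); [exact: cube_segment|exact: cube_segment|exact: xy].
Qed.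

End CoordinateCurves.

(** The case of [dr_coordinate_ub] in which a single coordinate moves; the others get width 0. *)
Lemma dr_marginal_antitone x y i h : cube x -> cube y -> lev x y -> 0 <= h ->
  cube (x + h *: delta_mx 0 i) -> cube (y + h *: delta_mx 0 i) ->
  F (y + h *: delta_mx 0 i) - F y <= F (x + h *: delta_mx 0 i) - F x.
Proof.
move=> cx cy xy h0 cxh cyh.
have := @dr_coordinate_ub y x (h *: delta_mx 0 i)
  (fun j => if j == i then h else 0) (fun=> 1) cy cyh cx.
rewrite (bigD1 i)//= eqxx big1 => [|j /negPf ->]; last first.
  by rewrite scale0r addr0 subrr mulr0.
rewrite addr0 mul1r; apply.
- by move=> j; case: eqP => [->//|_]; rewrite scale0r addr0.
- by move=> j; rewrite !mxE !eqxx /= mul1r; case: eqP => _; rewrite ?mulr1 ?mulr0.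
- by move=> j; rewrite !mxE; apply: mulr_ge0 => //; exact: ler0n.
move=> j t /andP[t0 t1] l; rewrite !mxE lerD// ler_wpM2l//.
case: (eqVneq j i) => [->//|_]; rewrite mul0r; apply: mulr_ge0 => //; exact: ler0n.
Qed.

End DRSubmodular.

(** * Continuous greedy with difference quotients *)

Section PackingPolytope.
Variables (R : realType) (n : nat) (P : set 'rV[R]_n).
Hypothesis packP : packing_polytope P.

Lemma packing0 : P 0.
Proof.
case: packP => _ [p Pp] Pcube Pdown.
apply: (Pdown _ p) => // i; rewrite mxE ?lexx ?ler01//.
by case/andP: (Pcube _ Pp i).
Qed.

(** As 0 lies in [P], every right-hand side [b k 0] is nonnegative; hence weights of total at most 1
    suffice. *)
Lemma packing_sum (I : finType) (c : I -> R) (p : I -> 'rV[R]_n) :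
  (forall i, 0 <= c i) -> \sum_i c i <= 1 -> (forall i, P (p i)) ->
  P (\sum_i c i *: p i).
Proof.
move=> c0 c1 Pp; have P0 := packing0.
case: packP => -[m [A [b PE]]] _ _ _.
rewrite PE /= in P0; rewrite PE /= => k.
have bk : 0 <= b k 0 by have := P0 k; rewrite trmx0 mulmx0 mxE.
rewrite raddf_sum /= mulmx_sumr summxE.
rewrite (@le_trans _ _ (\sum_i c i * b k 0))//; last first.
  by rewrite -mulr_suml ler_piMl.
apply: ler_sum => i _; rewrite linearZ /= -scalemxAr mxE ler_wpM2l//.
by have := Pp i; rewrite PE; apply.
Qed.

End PackingPolytope.

(** * Gain of a greedy step and of its iteration *)

Section Greedy.
Variables (R : realType) (n : nat) (F : 'rV[R]_n -> R) (P : set 'rV[R]_n).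
Variable lin : 'rV[R]_n -> 'rV[R]_n.

Definition box : 'rV[R]_n := \row_i lin (delta_mx 0 i) 0 i.

(* Where [box] vanishes all of P does, and division by zero makes the entry 0. *)
Definition difference_quotients (h : R) (x : 'rV[R]_n) : 'rV[R]_n :=
  \row_i ((F (x + (h * box 0 i) *: delta_mx 0 i) - F x) / (h * box 0 i)).

Definition greedy_step (h eps : R) (x : 'rV[R]_n) : 'rV[R]_n :=
  x + eps *: lin (difference_quotients h x).

Variable dF : 'rV[R]_n -> 'rV[R]_n.
Hypothesis FdF : dr_gradient F dF.
Hypothesis F0 : forall x, cube x -> 0 <= F x.
Hypothesis packP : packing_polytope P.
Hypothesis linP : linear_maximizer P lin.

Let Pcube x : P x -> cube x.
Proof. by case: packP => _ _ H _; exact: H. Qed.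

Lemma le_box x : P x -> lev x box.
Proof.
move=> Px i; rewrite mxE.
have [_ /(_ x Px)] := linP (delta_mx 0 i).
rewrite (bigD1 i)//= [in X in _ <= X](bigD1 i)//= !big1.
- by rewrite !addr0 mxE !eqxx !mul1r.
- by move=> j ji; rewrite mxE (negPf ji) andbF mul0r.
- by move=> j ji; rewrite mxE (negPf ji) andbF mul0r.
Qed.

Lemma cube_box : cube box.
Proof.
by move=> i; rewrite mxE; have [Pl _] := linP (delta_mx 0 i); exact: (Pcube Pl i).
Qed.

(** This point lies below [lin (delta_mx 0 i)]. The vector [box] itself may be outside [P], so it
    enters only through these multiples of unit vectors. *)
Lemma packing_box i : P (box 0 i *: delta_mx 0 i).
Proof.
case: packP => _ _ _ Pdown; case: (linP (delta_mx 0 i)) => Pl _; have ci := cube_box i.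
apply: (Pdown _ _ _ _ Pl) => j; rewrite !mxE eqxx /=; case: (eqVneq j i) => [ji|_].
- by rewrite mulr1; move: ci; rewrite mxE.
- by rewrite mulr0 lexx ler01.
- by rewrite ji mulr1.
- by rewrite mulr0; case/andP: (Pcube Pl j).
Qed.

Variables (h eps : R).
Hypotheses (h0 : 0 < h) (h1 : h <= 1 / 2) (eps0 : 0 < eps).

Let g := difference_quotients h.
Let step := greedy_step h eps.
Definition potential x := \sum_i box 0 i * difference_quotients h x 0 i.

(** Leaves room for a probe of width at most [h <= 1 / 2] in any coordinate, and keeps every factor
    [1 - x 0 i] at least 1/2. *)
Definition half_cube (x : 'rV[R]_n) := forall i, 0 <= x 0 i <= 1 / 2.

Lemma half_cube_cube x : half_cube x -> cube x.
Proof. by move=> hx i; have := hx i; lra. Qed.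

Lemma half_cube_bump x i : half_cube x ->
  cube (x + (h * box 0 i) *: delta_mx 0 i).
Proof.
move=> hx j; rewrite mxE [X in _ + X]mxE [delta_mx _ _ _ _]mxE eqxx /=.
have /andP[x0 x1] := hx j; have /andP[b0 b1] := cube_box i.
have hb0 : 0 <= h * box 0 i by rewrite mulr_ge0// ltW.
have hb1 : h * box 0 i <= h by rewrite ler_piMr// ltW.
have h2 := h1.
by case: (j == i); rewrite /= ?mulr1 ?mulr0; apply/andP; split; lra.
Qed.

Lemma difference_quotients_antitone x y : half_cube x -> half_cube y -> lev x y ->
  lev (g y) (g x).
Proof.
move=> hx hy xy i; rewrite [X in _ <= X]mxE [X in X <= _]mxE.
have /andP[b0 b1] := cube_box i.
rewrite ler_wpM2r ?invr_ge0 ?mulr_ge0//; first exact: ltW.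
apply: (dr_marginal_antitone FdF);
  [exact: half_cube_cube|exact: half_cube_cube|done|by rewrite mulr_ge0// ltW
  |exact: half_cube_bump|exact: half_cube_bump].
Qed.

(** With [v = lin (g x)] and [y = step x]: the gain is at least [eps <v, g y>]; replacing [g y] by
    [g x] costs a decrease of the potential; and [<v, g x> >= <d, g x> >= F (x + d) - F x >= F z / 2
    - F x]. *)
Lemma greedy_step_gain x z : half_cube x -> half_cube (step x) ->
  P z -> (forall i, 2 * h * box 0 i <= z 0 i) ->
  F x + eps * (F z / 2 - F x) - eps * (potential x - potential (step x)) <=
  F (step x) /\ potential (step x) <= potential x.
Proof.
move=> hx hy Pz hz; set y := step x.
have yE : y = x + eps *: lin (g x) by [].
have [Pv vmax] := linP (g x); set v := lin (g x) in yE Pv vmax.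
have v0 i : 0 <= v 0 i by case/andP: (Pcube Pv i).
have vb := le_box Pv.
have w0 i : 0 <= (eps *: v) 0 i by rewrite mxE mulr_ge0// ltW.
have xy : lev x y by move=> i; rewrite yE mxE lerDl.
have gxy := difference_quotients_antitone hx hy xy.
have b0 i : 0 <= box 0 i by case/andP: (cube_box i).
(* Where [box] vanishes so does [d], and the default value 0 of the division keeps the identity
   true. *)
have ratio (d : 'rV[R]_n) i : lev d box -> 0 <= d 0 i ->
    d 0 i / (h * box 0 i) * (h * box 0 i) = d 0 i.
  move=> db d0; have [bi0|bi0] := eqVneq (box 0 i) 0.
    by rewrite bi0 !mulr0; apply/eqP; rewrite eq_le d0 -bi0 db.
  by rewrite divfK// mulf_neq0// gt_eqF.
have pot : potential y <= potential x.
  by apply: ler_sum => i _; rewrite ler_wpM2l.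
split=> //.
(* All of the segment from [x] to [y] lies below [y], hence below the probes that start at [y]. *)
have gain : eps * (\sum_i v 0 i * g y 0 i) <= F y - F x.
  have := @dr_coordinate_lb _ _ _ _ FdF x y (eps *: v) (fun i => h * box 0 i)
    (fun i => eps * (v 0 i / (h * box 0 i))) (half_cube_cube hx).
  rewrite -yE => /(_ (half_cube_cube hy) (half_cube_cube hy)).
  move=> /(_ (fun i => half_cube_bump i hy)) H.
  rewrite mulr_sumr; apply: le_trans (H _ w0 _).
  - by rewrite le_eqVlt; apply/orP; left; apply/eqP/eq_bigr => i _; rewrite mxE; ring.
  - by move=> i; rewrite -mulrA ratio// mxE.
  - move=> i t /andP[t0 t1] j.
    apply: (@le_trans _ _ (y 0 j)).
      by rewrite yE [X in X <= _]mxE [X in _ <= X]mxE lerD2l mxE ler_piMl.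
    rewrite [X in _ <= X]mxE lerDl !mxE.
    by rewrite !mulr_ge0 ?ler0n ?(ltW h0)//; have := b0 i; rewrite mxE.
(* [x + d] is the probabilistic sum [1 - (1 - x)(1 - z)]. As [d <= z] it stays in [P], and
   [1 - x >= 1/2] gives [d >= h u]. *)
pose d : 'rV[R]_n := \row_i (z 0 i * (1 - x 0 i)).
have z01 := Pcube Pz.
have dz i : h * box 0 i <= d 0 i.
  rewrite [d _ _]mxE; have := hz i; have := z01 i; have := hx i.
  have : 0 <= h * box 0 i by rewrite mulr_ge0// ltW.
  nra.
have d0 i : 0 <= d 0 i by apply: le_trans (dz i); rewrite mulr_ge0// ltW.
have Pd : P d.
  case: packP => _ _ _ Pdown; apply: (Pdown _ _ _ _ Pz) => i; rewrite mxE; have := z01 i;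
    have := hx i; nra.
have cxd : cube (x + d).
  by move=> i; rewrite !mxE; have := z01 i; have := hx i; nra.
have loss : F (x + d) - F x <= \sum_i v 0 i * g x 0 i.
  apply: (@le_trans _ _ (\sum_i g x 0 i * d 0 i)); last first.
    apply: (le_trans (vmax _ Pd)).
    by rewrite le_eqVlt; apply/orP; left; apply/eqP/eq_bigr => i _; rewrite mulrC.
  have := @dr_coordinate_ub _ _ _ _ FdF x x d (fun i => h * box 0 i)
    (fun i => d 0 i / (h * box 0 i)) (half_cube_cube hx) cxd (half_cube_cube hx)
    (fun i => half_cube_bump i hx) (fun i => ratio d i (le_box Pd) (d0 i)) d0.
  move=> H; apply: le_trans (H _) _.
  - move=> i t /andP[t0 t1] j; rewrite [X in X <= _]mxE [X in _ <= X]mxE lerD2l.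
    rewrite mxE [X in _ <= X]mxE; apply: ler_wpM2l => //.
    rewrite mxE [delta_mx _ _ _ _]mxE eqxx /=.
    by case: eqP => [->|_]; rewrite ?mulr1 ?mulr0.
  - rewrite le_eqVlt; apply/orP; left; apply/eqP/eq_bigr => i _.
    by rewrite [g _ _ _]mxE; ring.
have Fz : F z / 2 <= F (x + d).
  (* [x + d = z + x (1 - z)] is the midpoint of [z] and [b]; [b] is in the cube because [2 x <= 1].
     Concavity and [F b >= 0] leave [F z / 2]. *)
  pose b : 'rV[R]_n := \row_i (z 0 i + 2 * (x 0 i * (1 - z 0 i))).
  have cb : cube b by move=> i; rewrite mxE; have := z01 i; have := hx i; nra.
  have zb : lev z b by move=> i; rewrite mxE; have := z01 i; have := hx i; nra.
  have := dr_concave (s := 1 / 2) FdF z01 cb zb.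
  have -> : z + (1 / 2) *: (b - z) = x + d.
    by apply/rowP => i; rewrite !mxE; field.
  by move=> H; have := F0 cb; lra.
(* Here [v <= box] meets the nonnegative differences [g x - g y]. *)
have : eps * (\sum_i v 0 i * g x 0 i) - eps * (\sum_i v 0 i * g y 0 i) <=
    eps * (potential x - potential y).
  rewrite -mulrBr ler_wpM2l ?(ltW eps0)// /potential -!sumrB; apply: ler_sum => i _.
  by rewrite -!mulrBr ler_wpM2r// subr_ge0.
have := ler_wpM2l (ltW eps0) (le_trans (lerB Fz (lexx (F x))) loss).
lra.
Qed.

Lemma greedy_iterE t : iter t step 0 =
  \sum_(i < t) eps *: lin (g (iter i step 0)).
Proof. by elim: t => [|t IH]; rewrite ?big_ord0// big_ord_recr/= -IH. Qed.

Lemma greedy_iter_packing t : t%:R * eps <= 1 -> P (iter t step 0).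
Proof.
move=> te; rewrite greedy_iterE.
apply: (packing_sum packP (c := fun=> eps)) => [i||i]; first exact: ltW.
  by rewrite sumr_const card_ord -mulr_natl.
by have [] := linP (g (iter i step 0)).
Qed.

Lemma greedy_iter_half t : t%:R * eps <= 1 / 2 -> half_cube (iter t step 0).
Proof.
move=> te i; rewrite greedy_iterE summxE.
have v01 (j : 'I_t) : 0 <= lin (g (iter j step 0)) 0 i <= 1.
  by have [/Pcube + _] := linP (g (iter j step 0)); apply.
apply/andP; split.
  apply: sumr_ge0 => j _; rewrite mxE mulr_ge0 ?(ltW eps0)//.
  by case/andP: (v01 j).
apply: le_trans te; rewrite mulr_natl -[t in leRHS]card_ord -sumr_const.
apply: ler_sum => j _; rewrite mxE ler_piMr ?(ltW eps0)//.
by case/andP: (v01 j).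
Qed.

Lemma greedy_iter_gain T z : T%:R * eps <= 1 / 2 ->
  P z -> (forall i, 2 * h * box 0 i <= z 0 i) ->
  (1 - (1 - eps) ^+ T) * (F z / 2) - eps * (potential 0 - potential (iter T step 0))
    <= F (iter T step 0) /\ potential (iter T step 0) <= potential 0.
Proof.
move=> + Pz hz; elim: T => [|T IH] Te.
  rewrite expr0 !subrr mulr0 !mul0r subrr; split=> //.
  exact: F0 (Pcube (packing0 packP)).
have e1 : eps <= 1 / 2.
  by apply: le_trans Te; rewrite ler_peMl ?(ltW eps0)// ler1n.
have Te' : T%:R * eps <= 1 / 2.
  by apply: le_trans Te; rewrite ler_wpM2r ?(ltW eps0)// ler_nat leqnSn.
have [H1 H2] := IH Te'.
have hT := greedy_iter_half Te; rewrite iterS in hT *.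
have [H3 H4] := greedy_step_gain (greedy_iter_half Te') hT Pz hz.
split; last exact: le_trans H4 H2.
rewrite exprS; move: H1 H2 H3 H4.
set x := iter T step 0; set p := potential x; set p0 := potential 0.
set q := potential (step x); set c := (1 - eps) ^+ T; set A := F z / 2.
move=> H1 H2 H3 _; apply: le_trans H3.
have H5 : (1 - eps) * ((1 - c) * A - eps * (p0 - p)) <= (1 - eps) * F x.
  by apply: ler_wpM2l H1; lra.
(* The recursion shrinks the error accumulated so far by [1 - eps]; that error is nonnegative
   because the potential has decreased, so the shrinkage may be dropped. *)
have : 0 <= eps * eps * (p0 - p) by rewrite !mulr_ge0 ?(ltW eps0)// subr_ge0.
lra.
Qed.

End Greedy.

(** A rational stand-in for [(1 - e)^t <= exp (- t e)]; at [t e = 1/2] it gives at most 2/3, the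
    source of the factor 1/3 in the guarantee. *)
Lemma bernoulli_inv (R : realFieldType) (e : R) t : 0 <= e <= 1 ->
  (1 - e) ^+ t * (1 + t%:R * e) <= 1.
Proof.
case/andP=> e0 e1; elim: t => [|t]; first by rewrite expr0 mul0r addr0 mulr1.
apply: le_trans; rewrite exprSr -mulrA ler_wpM2l ?exprn_ge0 ?subr_ge0//.
rewrite -natr1; have : 0 <= t%:R * e * e by rewrite !mulr_ge0.
nra.
Qed.

(** * Choice of parameters and the guarantee 2/13 *)

Section GreedyApproximation.
Variables (R : realType) (n : nat) (F : 'rV[R]_n -> R) (P : set 'rV[R]_n).
Variable lin : 'rV[R]_n -> 'rV[R]_n.

(* With grain L the probe width is h = 1/(2L^2) and the step size 1/(2L^4): the
   ratio 1/L^2 makes the telescoped error n/L^2 <= 1/1024, and 2hn = n/L^2 <= 1/32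
   leaves room in P for the lifted point. *)
Definition grain : nat := (32 * n.+1)%N.
Definition probe_width : R := 1 / (2 * (grain%:R * grain%:R)).
Definition step_size : R :=
  1 / (2 * ((grain%:R * grain%:R) * (grain%:R * grain%:R))).
Definition greedy_point : 'rV[R]_n :=
  iter (grain ^ 4) (greedy_step F lin probe_width step_size) 0.

Let h := probe_width.
Let eps := step_size.
Let u := box lin.
Let L : R := grain%:R.

Lemma grain_ge : 32 <= L.
Proof. by rewrite /L /grain natrM ler_peMr// ler1n. Qed.

Lemma grain_sqr : n%:R * 1024 <= L * L.
Proof.
rewrite /L /grain natrM -natr1; have : 0 <= n%:R :> R by [].
by move=> ?; nra.
Qed.

Hypothesis F0 : forall x, cube x -> 0 <= F x.
Hypothesis subF : smooth_submodular F.
Hypothesis packP : packing_polytope P.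
Hypothesis linP : linear_maximizer P lin.

Let Pcube x : P x -> cube x.
Proof. by case: packP => _ _ H _; exact: H. Qed.

Lemma probe_width_bounds : 0 < h /\ h <= 1 / 2048.
Proof.
have L32 := grain_ge; rewrite /h /probe_width -/L.
have LL : 1024 <= L * L by nra.
split; first by rewrite divr_gt0//; lra.
by rewrite ler_pdivrMr; lra.
Qed.

Lemma step_size_gt0 : 0 < eps.
Proof.
have L32 := grain_ge; rewrite /eps /step_size -/L.
by rewrite divr_gt0// !mulr_gt0//; lra.
Qed.

Lemma step_size_total : (grain ^ 4)%:R * eps = 1 / 2.
Proof.
have L32 := grain_ge; rewrite /eps /step_size natrX -/L.
by field; rewrite gt_eqF//; lra.
Qed.

Lemma step_size_probe_width : n%:R * eps <= h / 1024.
Proof.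
have L32 := grain_ge; have L2 := grain_sqr; have [h0 _] := probe_width_bounds.
have -> : n%:R * eps = h * (n%:R / (L * L)).
  by rewrite /h /eps /probe_width /step_size -/L; field; rewrite gt_eqF//; lra.
rewrite ler_pM2l// ler_pdivrMr; first lra.
by rewrite mulr_gt0//; lra.
Qed.

(** Take the best of [x] and the [n] probe points, all in [P]. Comparing with [o] instead of [x]
    bounds the initial potential by [F o] without any bound on derivatives. *)
Lemma probe_dominating x : P x -> exists o, [/\ P o, F x <= F o &
  forall i, F ((h * u 0 i) *: delta_mx 0 i) <= F o].
Proof.
move=> Px; have [h0 h1] := probe_width_bounds.
pose f (i : option 'I_n) := if i is Some j then (h * u 0 j) *: delta_mx 0 j else x.
have Pf i : P (f i).
  case: i => [i|//]; rewrite /f -scalerA.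
  have := packing_sum (I := 'I_1) packP (c := fun=> h)
    (p := fun=> u 0 i *: delta_mx 0 i); rewrite !big_ord1; apply=> [_||_].
  - exact: ltW.
  - lra.
  - exact: (packing_box packP linP).
case: (@arg_maxP _ _ _ None xpredT (fun i => F (f i))) => // i _ imax.
exists (f i); split => // [|j]; first exact: (imax None).
exact: (imax (Some j)).
Qed.

(** Shrinking [o] by 31/32 makes room for [2 h u], as [2 h n <= 1/32]. Each of the two moves keeps a
    fraction 31/32 of the value, and 961/1024 is the square. *)
Lemma lifted_point o : P o ->
  exists z, [/\ P z, forall i, 2 * h * u 0 i <= z 0 i & 961 / 1024 * F o <= F z].
Proof.
move=> Po; have [h0 h1] := probe_width_bounds; have [dF FdF] := smooth_submodular_dr subF.
have co := Pcube Po; have cu := cube_box packP linP.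
exists ((31 / 32) *: o + (2 * h) *: u); split.
- have := packing_sum (I := ('I_1 + 'I_n)%type) packP
    (c := fun i => if i is inr _ then 2 * h else 31 / 32)
    (p := fun i => if i is inr j then u 0 j *: delta_mx 0 j else o).
  rewrite !big_sumType /= !big_ord1.
  have -> : \sum_i (2 * h) *: (u 0 i *: 'e_i) = (2 * h) *: u.
    by rewrite -scaler_sumr -row_sum_delta.
  apply=> [[i|i]||[i|i]] //.
  - lra.
  - rewrite sumr_const card_ord -mulr_natl.
    suff : n%:R * (2 * h) <= 1 / 32 by lra.
    have L32 := grain_ge; have L2 := grain_sqr.
    have -> : n%:R * (2 * h) = n%:R / (L * L).
      by rewrite /h /probe_width -/L; field; rewrite gt_eqF//; lra.
    rewrite ler_pdivrMr; first by have : 0 <= n%:R :> R by []; lra.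
    by rewrite mulr_gt0//; lra.
  - exact: (packing_box packP linP).
- by move=> i; rewrite !mxE lerDr mulr_ge0//; case/andP: (co i).
pose o' := (31 / 32) *: o; pose b := o' + (1 / 32) *: u.
have co' : cube o' by move=> i; rewrite mxE; have := co i; lra.
have cb : cube b by move=> i; rewrite !mxE; have := cu i; have := co i; rewrite !mxE; lra.
have c0 : cube (0 : 'rV[R]_n) := Pcube (packing0 packP).
have H1 : 31 / 32 * F o <= F o'.
  have := dr_concave (s := 31 / 32) FdF c0 co.
  rewrite subr0 add0r -/o' => H.
  have {}H : (1 - 31 / 32) * F 0 + 31 / 32 * F o <= F o'.
    by apply: H; [move=> i; rewrite mxE; case/andP: (co i)|lra].
  by have := F0 c0; lra.
(* The lift [2 h u] is the fraction [64 h <= 1/32] of the way from [o'] to [b]. *)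
have := dr_concave (s := 64 * h) FdF co' cb.
have -> : o' + (64 * h) *: (b - o') = (31 / 32) *: o + (2 * h) *: u.
  by rewrite /b addrAC subrr add0r scalerA; congr (_ + _ *: _); field.
move=> H; have {}H : (1 - 64 * h) * F o' + 64 * h * F b <=
    F ((31 / 32) *: o + (2 * h) *: u).
  apply: H; last by lra.
  by move=> i; rewrite [X in _ <= X]mxE lerDl mxE mulr_ge0//; case/andP: (cu i).
have : 0 <= 64 * h * F b by rewrite mulr_ge0 ?F0//; lra.
have : 31 / 32 * F o' <= (1 - 64 * h) * F o' by rewrite ler_wpM2r ?F0//; lra.
lra.
Qed.

(** The weight [u 0 i] cancels the one in the denominator, so the potential is bounded in terms of
    [h] alone, however small [u 0 i] is. *)
Lemma potential_term y i : half_cube y ->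
  u 0 i * difference_quotients F lin h y 0 i =
    if u 0 i == 0 then 0 else (F (y + (h * u 0 i) *: delta_mx 0 i) - F y) / h.
Proof.
move=> hy; have [h0 _] := probe_width_bounds.
rewrite [X in _ * X]mxE -/u; have [->|ui0] := eqVneq (u 0 i) 0; first by rewrite mul0r.
by field; rewrite ui0 gt_eqF.
Qed.

Lemma potential_ub M : 0 <= M ->
  (forall i, F ((h * u 0 i) *: delta_mx 0 i) <= M) ->
  potential F lin h 0 <= n%:R * (M / h).
Proof.
move=> M0 HM; have [h0 _] := probe_width_bounds.
have half0 : half_cube (0 : 'rV[R]_n) by move=> i; rewrite mxE; lra.
rewrite -[X in X%:R]card_ord mulr_natl -sumr_const; apply: ler_sum => i _.
rewrite potential_term//; case: eqP => _; first by rewrite divr_ge0// ltW.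
rewrite ler_pM2r ?invr_gt0// add0r; have := HM i.
by have := F0 (half_cube_cube half0); lra.
Qed.

Lemma potential_lb y : half_cube y ->
  - (n%:R * (F y / h)) <= potential F lin h y.
Proof.
move=> hy; have [h0 h1] := probe_width_bounds; have Fy := F0 (half_cube_cube hy).
rewrite -mulrN -[X in X%:R]card_ord mulr_natl -sumr_const; apply: ler_sum => i _.
rewrite potential_term//; case: eqP => _; first by rewrite oppr_le0 divr_ge0// ltW.
rewrite -mulNr ler_pM2r ?invr_gt0// lerBrDr addNr F0//.
by apply: (half_cube_bump packP linP h0 _ _ hy); lra.
Qed.

Theorem greedy_approximation : approx_maximizer (2 / 13) F P greedy_point.
Proof.
have [h0 h1] := probe_width_bounds; have eps0 := step_size_gt0.
have [dF FdF] := smooth_submodular_dr subF; have Teps := step_size_total.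
split; first by apply: greedy_iter_packing => //; rewrite Teps; lra.
move=> x Px.
have [ o [Po Fxo Hprobe]] := probe_dominating Px.
have [z [Pz hz Fz]] := lifted_point Po.
have hle : h <= 1 / 2 by lra.
have hT : half_cube greedy_point.
  by apply: (greedy_iter_half _ packP linP _ eps0); rewrite Teps.
have [] := greedy_iter_gain (T := grain ^ 4) FdF F0 packP linP h0 hle eps0 _ Pz hz.
  by rewrite Teps.
rewrite -/greedy_point -/h -/eps => gain _.
have eps1 : eps <= 1.
  have : 1 * eps <= (grain ^ 4)%:R * eps.
    by rewrite ler_wpM2r ?(ltW eps0)// ler1n expn_gt0.
  by rewrite Teps; lra.
have := @bernoulli_inv _ eps (grain ^ 4); rewrite Teps (ltW eps0) eps1 => /(_ isT).
move: gain; set c := (1 - eps) ^+ _ => gain hc.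
have Fo0 := F0 (Pcube Po).
have FT0 := F0 (half_cube_cube hT).
have pot0 := potential_ub Fo0 Hprobe; have potT := potential_lb hT.
have loss : eps * (potential F lin h 0 - potential F lin h greedy_point) <=
    (F o + F greedy_point) / 1024.
  have H1 := ler_wpM2l (ltW eps0) (lerB pot0 potT).
  apply: (le_trans H1); have -> : eps * (n%:R * (F o / h) -
    - (n%:R * (F greedy_point / h))) = (n%:R * eps) * ((F o + F greedy_point) / h).
    by rewrite opprK -mulrDr -mulrDl mulrA (mulrC eps).
  have -> : (F o + F greedy_point) / 1024 =
    h / 1024 * ((F o + F greedy_point) / h) by field; rewrite gt_eqF.
  by rewrite ler_wpM2r ?step_size_probe_width// divr_ge0 ?addr_ge0// ltW.
(* Together with [loss] this yields [F greedy_point >= 955/6150 * F o], which exceeds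
   [2/13 * F o]. *)
have : 1 / 3 * (961 / 1024 * F o / 2) <= (1 - c) * (F z / 2).
  by apply: ler_pM; lra.
lra.
Qed.

End GreedyApproximation.

(** * The real-RAM program *)

Definition for_each (body : cmd) : cmd :=
  Seq (NSet 1 (NConst 0))
    (While (BNLt (NReg 1) (NReg 0))
      (Seq body (NSet 1 (NAdd (NReg 1) (NConst 1))))).

Definition two_expr := RAdd ROne ROne.
Definition sixteen_expr := RMul (RMul two_expr two_expr) (RMul two_expr two_expr).
Definition grain_sqr_expr := RMul (RReg 0) (RReg 0).
Definition probe_expr := RDiv ROne (RMul two_expr grain_sqr_expr).
Definition step_expr :=
  RDiv ROne (RMul two_expr (RMul grain_sqr_expr grain_sqr_expr)).
Definition entry (a : nat) := RGet a (NReg 1).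

(* Real register 0 holds the grain and real register 1 the step counter;
   array 1 holds the box, arrays 2 and 3 are oracle queries, array 4 the
   answers of the linear maximizer. *)
Definition compute_grain : cmd :=
  Seq (for_each (RSet 0 (RAdd (RReg 0) ROne)))
    (RSet 0 (RMul (RMul sixteen_expr two_expr) (RAdd (RReg 0) ROne))).

Definition compute_box : cmd :=
  for_each (Seq (ASet 3 (NReg 1) ROne) (Seq (QLin 4 3)
    (Seq (ASet 1 (NReg 1) (entry 4)) (ASet 3 (NReg 1) RZero)))).

Definition probe_bump := RMul probe_expr (entry 1).

(** Each probe is made in place in array 0 and undone by subtraction, which is exact in real
    arithmetic. *)
Definition compute_quotients : cmd :=
  Seq (QValue 2 0)
    (for_each (Seq (ASet 0 (NReg 1) (RAdd (entry 0) probe_bump))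
      (Seq (QValue 3 0)
      (Seq (ASet 0 (NReg 1) (RSub (entry 0) probe_bump))
        (ASet 2 (NReg 1) (RDiv (RSub (RReg 3) (RReg 2)) probe_bump)))))).

Definition greedy_body : cmd :=
  Seq compute_quotients (Seq (QLin 4 2)
    (Seq (for_each (ASet 0 (NReg 1) (RAdd (entry 0) (RMul step_expr (entry 4)))))
      (RSet 1 (RAdd (RReg 1) ROne)))).

(** The step counter is real because its bound, the fourth power of the grain, is computed by real
    multiplication. *)
Definition greedy_program : cmd :=
  Seq compute_grain (Seq compute_box
    (While (BRLt (RReg 1) (RMul grain_sqr_expr grain_sqr_expr)) greedy_body)).

(** * Correctness and running time of the program *)

Section Execution.
Variables (R : realType) (n : nat) (F : 'rV[R]_n -> R) (lin : 'rV[R]_n -> 'rV[R]_n).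
Implicit Types (s : state R) (Q : state R -> Prop).

(** Total correctness with a time budget; the postcondition serves as a continuation, so proofs
    follow the program text. *)
Definition reaches c s t Q := exists s' t',
  [/\ exec F lin c s s' t', (t' <= t)%N & Q s'].

Lemma reaches_imp c s t Q Q' : (forall s', Q s' -> Q' s') ->
  reaches c s t Q -> reaches c s t Q'.
Proof. by move=> QQ' [s' [t' [? ? /QQ' ?]]]; exists s', t'. Qed.

Lemma reaches_nset s k e Q : Q (set_nreg s k (neval s e)) -> reaches (NSet k e) s 1 Q.
Proof.
move=> HQ; exists (set_nreg s k (neval s e)), 1%N.
by split=> //; exact: ExecNSet.
Qed.

Lemma reaches_rset s k e Q : Q (set_rreg s k (reval s e)) -> reaches (RSet k e) s 1 Q.
Proof.
move=> HQ; exists (set_rreg s k (reval s e)), 1%N.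
by split=> //; exact: ExecRSet.
Qed.

Lemma reaches_aset s a i e Q :
  Q (set_array s a (upd (arrays s a) (neval s i) (reval s e))) ->
  reaches (ASet a i e) s 1 Q.
Proof.
move=> HQ; exists (set_array s a (upd (arrays s a) (neval s i) (reval s e))), 1%N.
by split=> //; exact: ExecASet.
Qed.

Lemma reaches_qvalue s k a Q :
  Q (set_rreg s k (F (vec_of_array n (arrays s a)))) -> reaches (QValue k a) s n.+1 Q.
Proof.
move=> HQ; exists (set_rreg s k (F (vec_of_array n (arrays s a)))), n.+1.
by split=> //; exact: ExecQValue.
Qed.

Lemma reaches_qlin s a b Q :
  Q (set_array s a (array_of_vec (lin (vec_of_array n (arrays s b))))) ->
  reaches (QLin a b) s n.+1 Q.
Proof.
move=> HQ.
exists (set_array s a (array_of_vec (lin (vec_of_array n (arrays s b))))), n.+1.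
by split=> //; exact: ExecQLin.
Qed.

Lemma reaches_seq c1 c2 s t1 t2 Q :
  reaches c1 s t1 (fun s' => reaches c2 s' t2 Q) ->
  reaches (Seq c1 c2) s (t1 + t2) Q.
Proof.
move=> [s1 [u1 [E1 le1 [s2 [u2 [E2 le2 HQ]]]]]]; exists s2, (u1 + u2)%N.
by split=> //; [exact: ExecSeq E1 E2|exact: leq_add].
Qed.

Lemma reaches_while b c s t K (I : nat -> state R -> Prop) : I 0%N s ->
  (forall k s', (k < K)%N -> I k s' -> beval s' b /\ reaches c s' t (I k.+1)) ->
  (forall s', I K s' -> ~~ beval s' b) ->
  reaches (While b c) s (K * t.+1 + 1) (I K).
Proof.
move=> I0 Hstep Hend.
suff H m k s' : (m + k = K)%N -> I k s' -> reaches (While b c) s' (m * t.+1 + 1) (I K).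
  by apply: H I0; rewrite addn0.
elim: m k s' => [|m IH] k s' mk Ik.
  rewrite add0n in mk; rewrite -mk in Hend *.
  by exists s', 1%N; split=> //; apply: ExecWhileEnd; exact: Hend.
have [|Hb [s1 [t1 [E1 le1 I1]]]] := Hstep k s' _ Ik; first by lia.
have [|s2 [t2 [E2 le2 I2]]] := IH k.+1 s1 _ I1; first by lia.
exists s2, (t1 + t2).+1; split=> //; first exact: ExecWhileStep Hb E1 E2.
by rewrite mulSn addSn addSn ltnS -addnA leq_add.
Qed.

(** Per round: the body, the increment and the test; besides these, the initialization and the last,
    failing test. *)
Definition for_time t := (1 + (n * (t + 1).+1 + 1))%N.

Lemma reaches_for_each body s t
    (I : nat -> (nat -> R) -> (nat -> nat -> R) -> Prop) :
  nregs s 0 = n -> I 0%N (rregs s) (arrays s) ->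
  (forall i s', (i < n)%N -> nregs s' 1 = i -> I i (rregs s') (arrays s') ->
     reaches body s' t (fun s'' => nregs s'' = nregs s' /\
       I i.+1 (rregs s'') (arrays s''))) ->
  reaches (for_each body) s (for_time t)
    (fun s' => nregs s' 0 = n /\ I n (rregs s') (arrays s')).
Proof.
move=> ns I0 H; apply/reaches_seq/reaches_nset.
pose J i s' := [/\ nregs s' 0 = n, nregs s' 1 = i & I i (rregs s') (arrays s')].
apply: (@reaches_imp _ _ _ (J n)) => [s' []//|].
apply: reaches_while => [|k s' kn [n0 n1 Ik]|s' [n0 n1 _]].
- by [].
- split; first by rewrite /= n0 n1.
  apply: reaches_seq; apply: reaches_imp (H _ _ kn n1 Ik) => s'' [nn Ik'].
  by apply: reaches_nset; rewrite /J /= /upd /= nn n0 n1 addn1.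
- by rewrite /= n0 n1 ltnn.
Qed.

Definition stores (A : nat -> nat -> R) a (x : 'rV[R]_n) :=
  forall j : 'I_n, A a j = x 0 j.

Lemma stores_vec A a x : stores A a x -> vec_of_array n (A a) = x.
Proof. by move=> Ax; apply/rowP => j; rewrite mxE. Qed.

Lemma array_of_vecE (x : 'rV[R]_n) (j : 'I_n) : array_of_vec x j = x 0 j.
Proof. by rewrite /array_of_vec valK. Qed.

(** Naturals cannot be converted to reals, so the loop counts [n] up in a real register. *)
Lemma compute_grain_reaches :
  reaches compute_grain (init_state R n) (for_time 1 + 1)
    (fun s => [/\ nregs s 0 = n, rregs s 0 = (grain n)%:R, rregs s 1 = 0 &
      arrays s = fun _ _ => 0]).
Proof.
apply: reaches_seq; apply: reaches_imp; last first.
  apply: (reaches_for_each (I := fun i r A => [/\ r 0%N = i%:R, r 1%N = 0 &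
    A = fun _ _ => 0])) => // i s _ _ [r0 r1 A0].
  by apply: reaches_rset; rewrite /= /upd /= r0 r1 A0 natr1.
move=> s [n0 [r0 r1 A0]]; apply: reaches_rset; split=> //=.
rewrite /upd /= r0 natr1 /grain natrM; congr (_ * _); ring.
Qed.

Lemma compute_box_reaches s : nregs s 0 = n -> rregs s 0 = (grain n)%:R ->
  rregs s 1 = 0 -> arrays s = (fun _ _ => 0) ->
  reaches compute_box s (for_time (1 + (n.+1 + (1 + 1))))
    (fun s => [/\ nregs s 0 = n, rregs s 0 = (grain n)%:R, rregs s 1 = 0,
      stores (arrays s) 0 0 & stores (arrays s) 1 (box lin)]).
Proof.
move=> n0 r0 r1 A0; apply: reaches_imp; last first.
  apply: (reaches_for_each (I := fun i r A => [/\ r 0%N = (grain n)%:R, r 1%N = 0,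
    stores A 0 0, stores A 3 0 & forall j : 'I_n, (j < i)%N -> A 1%N j = box lin 0 j])).
  - by [].
  - by split=> // j; rewrite A0 mxE.
  move=> i {n0 r0 r1 A0}s lt_in n1 [r0 r1 A0 A3 A1].
  apply/reaches_seq/reaches_aset/reaches_seq/reaches_qlin/reaches_seq.
  apply/reaches_aset/reaches_aset; split=> //; split=> //.
  (* Array 3 is reset to zero, so the next query is again a unit vector. *)
  - by move=> j; rewrite /= /upd /= n1; case: ifP => ji; rewrite ?ji ?A3 mxE.
  - move=> j; rewrite /= /upd /= n1 => ji.
    case: eqP => [{}ji|/eqP nji]; last by apply: A1; lia.
    have -> : i = Ordinal lt_in by [].
    rewrite array_of_vecE mxE; have -> : j = Ordinal lt_in by exact: val_inj.
    congr (lin _ _ _); apply/rowP => l; rewrite !mxE /=.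
    by rewrite -val_eqE /= A3 mxE; case: eqP.
by move=> s' [? [? ? ? _ A1]]; split => // j; exact: A1.
Qed.

Lemma compute_quotients_reaches s x :
  nregs s 0 = n -> rregs s 0 = (grain n)%:R ->
  stores (arrays s) 0 x -> stores (arrays s) 1 (box lin) ->
  reaches compute_quotients s
    (n.+1 + for_time (1 + (n.+1 + (1 + 1))))
    (fun s' => nregs s' 0 = n /\
      [/\ rregs s' 0 = (grain n)%:R, rregs s' 1 = rregs s 1,
      stores (arrays s') 0 x, stores (arrays s') 1 (box lin) &
      stores (arrays s') 2 (difference_quotients F lin (probe_width R n) x)]).
Proof.
move=> n0 r0 A0 A1; apply/reaches_seq/reaches_qvalue; apply: reaches_imp; last first.
  apply: (reaches_for_each (I := fun i r A => r 2%N = F x /\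
    [/\ r 0%N = (grain n)%:R, r 1%N = rregs s 1, stores A 0 x, stores A 1 (box lin) &
    forall j : 'I_n, (j < i)%N ->
      A 2%N j = difference_quotients F lin (probe_width R n) x 0 j])) => //.
    by split=> //=; rewrite /upd/= (stores_vec A0).
  move=> i s' lt_in n1 [r2' [r0' r1' A0' A1' A2']].
  pose o := Ordinal lt_in; have io : i = o by [].
  apply/reaches_seq/reaches_aset/reaches_seq/reaches_qvalue/reaches_seq.
  apply/reaches_aset/reaches_aset; split=> //; split=> //; split=> //.
  - move=> j; rewrite /= /upd /= n1 r0' eqxx.
    by case: eqP => [<-|_]; rewrite ?addrK; exact: A0'.
  - move=> j; rewrite /= /upd /= n1 => ji.
    case: eqP => [{}ji|/eqP nji]; last by apply: A2'; lia.
    have -> : j = o by exact: val_inj.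
    rewrite r0' r2' io A1' [RHS]mxE -[1 / _]/(probe_width R n).
    congr ((F _ - F x) / _).
    apply/rowP => l; rewrite !mxE /= -val_eqE /= io !A0'.
    by case: eqP => [/val_inj ->|_]; rewrite ?mulr1 ?mulr0 ?addr0.
by move=> s' [? [_ [? ? ? ? A2]]]; split => //; split => // j; exact: A2.
Qed.

Definition body_time := (n.+1 + for_time (1 + (n.+1 + (1 + 1))) +
  (n.+1 + (for_time 1 + 1)))%N.

Lemma greedy_body_reaches s x k :
  nregs s 0 = n -> rregs s 0 = (grain n)%:R -> rregs s 1 = k%:R ->
  stores (arrays s) 0 x -> stores (arrays s) 1 (box lin) ->
  reaches greedy_body s body_time
    (fun s' => [/\ nregs s' 0 = n, rregs s' 0 = (grain n)%:R, rregs s' 1 = k.+1%:R,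
      stores (arrays s') 0 (greedy_step F lin (probe_width R n) (step_size R n) x) &
      stores (arrays s') 1 (box lin)]).
Proof.
move=> n0 r0 r1 A0 A1; apply: reaches_seq.
apply: reaches_imp (compute_quotients_reaches n0 r0 A0 A1) => s1.
rewrite r1 => -[{}n0 [{}r0 {}r1 {}A0 {}A1 A2]].
apply/reaches_seq/reaches_qlin/reaches_seq; rewrite (stores_vec A2).
set v := lin _; apply: reaches_imp; last first.
  apply: (reaches_for_each (I := fun i r A => [/\ r 0%N = (grain n)%:R,
    r 1%N = k%:R, stores A 4 v, stores A 1 (box lin) &
    forall j : 'I_n, A 0%N j = x 0 j + if (j < i)%N then step_size R n * v 0 j else 0])).
  - by [].
  - split=> //= j; rewrite /upd /=; first exact: array_of_vecE.
    by rewrite addr0 A0.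
  move=> i s' lt_in n1 [r0' r1' A4' A1' A0'].
  pose o := Ordinal lt_in; have io : i = o by [].
  apply: reaches_aset; split=> //; split=> //= j; rewrite /upd /= n1.
  case: eqP => [ji|/eqP nji]; last first.
    by rewrite A0' ltnS (leq_eqVlt j) (negPf nji).
  have -> : j = o by exact: val_inj.
  by rewrite r0' io A0' A4' ltnn addr0 ltnSn.
move=> s' [{}n0 [{}r0 {}r1 _ {}A1 {}A0]]; apply: reaches_rset; split=> //=.
  by rewrite /upd /= r1 natr1.
by move=> j; rewrite A0 ltn_ord !mxE.
Qed.

Definition program_time := (for_time 1 + 1 + (for_time (1 + (n.+1 + (1 + 1))) +
  (grain n ^ 4 * body_time.+1 + 1)))%N.

Lemma greedy_program_reaches :
  reaches greedy_program (init_state R n) program_time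
    (fun s => output n s = greedy_point F lin).
Proof.
apply/reaches_seq; apply: reaches_imp compute_grain_reaches => s [n0 r0 r1 A0].
apply/reaches_seq; apply: reaches_imp (compute_box_reaches n0 r0 r1 A0).
move=> {n0 r0 r1 A0}s [n0 r0 r1 A0 A1].
pose I k s' := [/\ nregs s' 0 = n, rregs s' 0 = (grain n)%:R, rregs s' 1 = k%:R,
  stores (arrays s') 0
    (iter k (greedy_step F lin (probe_width R n) (step_size R n)) 0) &
  stores (arrays s') 1 (box lin)].
apply: (@reaches_imp _ _ _ (I (grain n ^ 4)%N)) => [s' [_ _ _ + _]|].
  exact: stores_vec.
have guard s' k : I k s' ->
    beval s' (BRLt (RReg 1) (RMul grain_sqr_expr grain_sqr_expr)) = (k < grain n ^ 4)%N.
  move=> [_ r0' r1' _ _]; rewrite /= r0' r1' -!natrM ltr_nat; congr (_ < _)%N.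
  by rewrite !expnS expn0 muln1 !mulnA.
apply: reaches_while => // [k s' kK Ik|s' /guard ->]; last by rewrite ltnn.
split; first by rewrite (guard _ _ Ik).
by case: Ik => *; exact: greedy_body_reaches.
Qed.

End Execution.

(** * Polynomial time bound and conclusion *)

Definition time_poly : {poly nat} :=
  let for_poly (t : {poly nat}) := 1 + ('X * (t + 2%:P) + 1) in
  let short := for_poly (1 + ('X + 1 + (1 + 1))) in
  let grain_poly := 32%:P * ('X + 1) in
  for_poly 1 + 1 + (short + (grain_poly * grain_poly * (grain_poly * grain_poly) *
    (('X + 1 + short + ('X + 1 + (for_poly 1 + 1))) + 1) + 1)).

Lemma time_polyE n : time_poly.[n] = program_time n.
Proof.
rewrite /time_poly !(hornerD, hornerM, hornerX, hornerC) -/(1%R : {poly nat}).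
rewrite /program_time /body_time /for_time /grain.
rewrite !natrDE !natrME ?natr1E !addn1 !addn2 !expnS expn0 muln1 !mulnA.
reflexivity.
Qed.

Theorem theorem3 :
  exists (prog : cmd) (time : {poly nat}),
  forall (R : realType) (n : nat) (F : 'rV[R]_n -> R) (P : set 'rV[R]_n)
    (lin : 'rV[R]_n -> 'rV[R]_n),
  (forall x, cube x -> 0 <= F x) ->
  smooth_submodular F ->
  packing_polytope P ->
  linear_maximizer P lin ->
  exists (s : state R) (t : nat),
    [/\ exec F lin prog (init_state R n) s t,
        (t <= time.[n])%N
      & approx_maximizer ((2 * expR 1 - 2) / (13 * expR 1 - 9)) F P
          (output n s)].
Proof.
exists greedy_program, time_poly => R n F P lin F0 subF packP linP.
have [s [t [Est tle out]]] := greedy_program_reaches F lin.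
exists s, t; rewrite time_polyE out; split=> //.
have [Pg approx] := greedy_approximation F0 subF packP linP.
split=> // x Px; apply: le_trans (approx x Px); apply: ler_wpM2r.
  by case: packP => _ _ Pcube _; exact/F0/Pcube.
(* Cross-multiplied, the comparison with 2/13 reads [26 e - 26 <= 26 e - 18]; [1 < e] makes the
   denominator positive. *)
have e1 : 1 < expR 1 :> R by rewrite expR_gt1.
by rewrite ler_pdivrMr; lra.
Qed.
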